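(* Let $\mathcal{X}_{P_v}(z):=\sum_{n\ge 1} X_{P_{n,v}}\, z^{n+1}$ be the generating function for the chromatic symmetric functions of the paths twinned at a leaf. Then $$\frac12\,\mathcal{X}_{P_v}(z)=K(z)\frac{G_{\ge 3}(z)}{D(z)}+e_1z\,G(z)\frac{G_{\ge 3}(z)}{D(z)}+e_2z^2+\sum_{i\ge 3} i\,e_i z^i+e_1z\,G_{\ge 3}(z).$$ In particular $X_{P_{n,v}}$ is $e$-positive (for all $n\ge 1$), and the initial values are $X_{P_{1,v}}=2e_2$, $X_{P_{2,v}}=2(3e_3)$, $X_{P_{3,v}}=2(4e_4+2e_1e_3)$, $X_{P_{4,v}}=2(4e_2e_3+3e_1e_4+5e_5)$. Moreover, in terms of the path generating function $\mathcal{X}_P(z)$, one has the $e$-positive expression $$\frac12\,\mathcal{X}_{P_v}(z)=\mathcal{X}_P(z)\,G_{\ge 3}(z)+\sum_{i\ge 2} e_i z^i .$$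
   Context: The chromatic symmetric function of a finite simple graph $H=(V,E)$ is $X_H=\sum_\kappa\prod_{u\in V}x_{\kappa(u)}$, the sum over all proper colorings $\kappa:V\to\mathbb{Z}_{>0}$. $P_n$ is the path on $n$ vertices ($X_{P_0}=1$). The twin $H_v$ of a graph $H$ at a vertex $v$ is obtained by adding a new vertex $v'$ joined to $v$ and to all neighbors of $v$. $P_{n,v}$ denotes $P_n$ twinned at $v$, where $v$ is an end vertex (leaf) of $P_n$ (for $n=1$, $v$ is the only vertex). $e_i$ is the $i$-th elementary symmetric function; a symmetric function is $e$-positive if its expansion in the basis of elementary symmetric functions $e_\lambda$ has nonnegative coefficients, and a power series in $z$ over symmetric functions is $e$-positive if each of its coefficients is. Notation: $\mathcal{X}_P(z)=\sum_{n\ge 0}X_{P_n}z^n$, $K(z)=\sum_{i\ge 2} i e_i z^i$, $G(z)=\sum_{i\ge 2}(i-1)e_iz^i$, $G_{\ge k}(z)=\sum_{i\ge k}(i-1)e_iz^i$, $D(z)=1-G(z)$. *)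

(* Defs.v *)
From HB Require Import structures.
From mathcomp Require Import all_boot all_order all_algebra finmap.
From mathcomp Require Import boolp classical_sets functions cardinality fsbigop.

Set Implicit Arguments.
Unset Strict Implicit.
Unset Printing Implicit Defensive.

Import Order.TTheory GRing.Theory Num.Theory.

Local Open Scope ring_scope.
Local Open Scope classical_set_scope.

(* Additive monoids of exponents in which every element is a sum of two
   elements in finitely many ways, so that power series can be multiplied. *)
HB.mixin Record hasFiniteDecomp M of GRing.Nmodule M := {
  finite_decomp : forall m : M, finite_set [set p : M * M | p.1 + p.2 = m]
}.
#[short(type="expType")]
HB.structure Definition Exponents := {M of GRing.Nmodule M & hasFiniteDecomp M}.

(* Formal power series: arbitrary families of coefficients in R indexed by the
   exponents M. *)
Record series (M : expType) (R : Type) := Series { coef : M -> R }.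

Lemma seriesP (M : expType) (R : Type) (f g : series M R) :
  coef f =1 coef g -> f = g.
Proof. by case: f g => [f] [g] /= /funext ->. Qed.

HB.instance Definition _ (M : expType) (R : Type) := gen_eqMixin (series M R).
HB.instance Definition _ (M : expType) (R : Type) :=
  gen_choiceMixin (series M R).

Section SeriesRing.
Variables (M : expType) (R : comNzRingType).
Implicit Types f g h : series M R.

Definition series_zero : series M R := Series (fun=> 0).
Definition series_opp f : series M R := Series (fun m => - coef f m).
Definition series_add f g : series M R := Series (fun m => coef f m + coef g m).
Definition series_one : series M R := Series (fun m => (m == 0)%:R).
Definition series_mul f g : series M R :=
  Series (fun m => \sum_(p \in [set p : M * M | p.1 + p.2 = m])
                     coef f p.1 * coef g p.2).
Definition series_scale (a : R) f : series M R :=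
  Series (fun m => a * coef f m).

Fact series_addA : associative series_add.
Proof. by move=> f g h; apply: seriesP => m /=; rewrite addrA. Qed.
Fact series_addC : commutative series_add.
Proof. by move=> f g; apply: seriesP => m /=; rewrite addrC. Qed.
Fact series_add0 : left_id series_zero series_add.
Proof. by move=> f; apply: seriesP => m /=; rewrite add0r. Qed.
Fact series_addN : left_inverse series_zero series_opp series_add.
Proof. by move=> f; apply: seriesP => m /=; rewrite addNr. Qed.

HB.instance Definition _ := GRing.isZmodule.Build (series M R)
  series_addA series_addC series_add0 series_addN.

Definition decomp (m : M) : seq (M * M) :=
  fset_set [set p : M * M | p.1 + p.2 = m].

Fact mem_decomp m p : (p \in decomp m) = (p.1 + p.2 == m).
Proof.
rewrite /decomp in_fset_set; last exact: finite_decomp.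
by apply/idP/eqP; rewrite in_setE.
Qed.

Fact decomp_uniq m : uniq (decomp m).
Proof. exact: fset_uniq. Qed.

Fact coef_series_mul f g m :
  coef (series_mul f g) m = \sum_(p <- decomp m) coef f p.1 * coef g p.2.
Proof. by rewrite /= fsbig_finite //; exact: finite_decomp. Qed.

Fact series_mulC : commutative series_mul.
Proof.
move=> f g; apply: seriesP => m; rewrite !coef_series_mul.
have -> : \sum_(p <- decomp m) coef g p.1 * coef f p.2 =
          \sum_(p <- map swap_pair (decomp m)) coef f p.1 * coef g p.2.
  by rewrite big_map; apply: eq_bigr => p _ /=; rewrite mulrC.
apply: perm_big; apply: uniq_perm; rewrite ?decomp_uniq //.
  by rewrite map_inj_uniq ?decomp_uniq // => -[a b] [c d] [-> ->].
move=> [a b]; rewrite mem_decomp /= addrC; apply/eqP/mapP => /=.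
  by move=> ab; exists (b, a) => //; rewrite mem_decomp /= ab.
by case=> -[c d]; rewrite mem_decomp => /eqP /= <- [-> ->].
Qed.

Fact series_mul1 : left_id series_one series_mul.
Proof.
move=> f; apply: seriesP => m; rewrite coef_series_mul /=.
rewrite (bigD1_seq (0, m)) ?mem_decomp ?decomp_uniq ?add0r //=.
rewrite eqxx mul1r big_seq_cond big1 ?addr0 // => -[a b] /andP[].
rewrite mem_decomp /= => /eqP <-; case: (a =P 0) => [->|]; rewrite ?mul0r //.
by rewrite add0r eqxx.
Qed.

Fact series_mulDl : left_distributive series_mul series_add.
Proof.
move=> f g h; apply: seriesP => m; transitivity (coef (series_mul f h) m + coef (series_mul g h) m) => //.
rewrite !coef_series_mul -big_split /=.
by apply: eq_bigr => p _; rewrite mulrDl.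
Qed.

Fact series_mulA : associative series_mul.
Proof.
move=> f g h; apply: seriesP => m; rewrite !coef_series_mul.
under eq_bigr do rewrite coef_series_mul big_distrr /=.
under [RHS]eq_bigr do rewrite coef_series_mul big_distrl /=.
pose F (t : M * M * M) := coef f t.1.1 * coef g t.1.2 * coef h t.2.
pose s1 := [seq (p.1, q.1, q.2) | p <- decomp m, q <- decomp p.2].
pose s2 := [seq (q.1, q.2, p.2) | p <- decomp m, q <- decomp p.1].
transitivity (\sum_(t <- s1) F t).
  rewrite big_allpairs_dep; apply: eq_bigr => p _; apply: eq_bigr => q _.
  by rewrite /F /= mulrA.
transitivity (\sum_(t <- s2) F t); last first.
  by rewrite big_allpairs_dep; apply: eq_bigr => p _; apply: eq_bigr => q _.
apply: perm_big; apply: uniq_perm.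
- apply: allpairs_uniq_dep => [|p _|]; rewrite ?decomp_uniq //.
  move=> [[a b] [c d]] [[a' b'] [c' d']].
  move=> /allpairsPdep[x [y [xm yx [eab ecd]]]].
  move=> /allpairsPdep[x' [y' [xm' yx' [eab' ecd']]]] /= [? ? ?]; subst.
  by move: yx yx'; rewrite !mem_decomp /= => /eqP-> /eqP->.
- apply: allpairs_uniq_dep => [|p _|]; rewrite ?decomp_uniq //.
  move=> [[a b] [c d]] [[a' b'] [c' d']].
  move=> /allpairsPdep[x [y [xm yx [eab ecd]]]].
  move=> /allpairsPdep[x' [y' [xm' yx' [eab' ecd']]]] /= [? ? ?]; subst.
  by move: yx yx'; rewrite !mem_decomp /= => /eqP-> /eqP->.
move=> [[a b] c]; apply/allpairsPdep/allpairsPdep => /=.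
- move=> [[x y] [[z w] []]]; rewrite !mem_decomp /= => /eqP xy /eqP zw [-> -> ->].
  by exists (x + z, w), (x, z); rewrite !mem_decomp /= -addrA zw xy !eqxx.
- move=> [[x y] [[z w] []]]; rewrite !mem_decomp /= => /eqP xy /eqP zw [-> -> ->].
  by exists (z, w + y), (w, y); rewrite !mem_decomp /= addrA zw xy !eqxx.
Qed.

Fact series_one_neq0 : series_one != 0.
Proof.
apply/eqP => /(congr1 (fun f => coef f 0)) /= /eqP.
by rewrite eqxx oner_eq0.
Qed.

HB.instance Definition _ := GRing.Zmodule_isComNzRing.Build (series M R)
  series_mulA series_mulC series_mul1 series_mulDl series_one_neq0.

Fact series_scaleA a b f :
  series_scale a (series_scale b f) = series_scale (a * b) f.
Proof. by apply: seriesP => m /=; rewrite mulrA. Qed.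
Fact series_scale1 : left_id 1 series_scale.
Proof. by move=> f; apply: seriesP => m /=; rewrite mul1r. Qed.
Fact series_scaleDr : right_distributive series_scale +%R.
Proof. by move=> a f g; apply: seriesP => m /=; rewrite mulrDr. Qed.
Fact series_scaleDl f : {morph series_scale^~ f : a b / a + b}.
Proof. by move=> a b; apply: seriesP => m /=; rewrite mulrDl. Qed.

HB.instance Definition _ := GRing.Zmodule_isLmodule.Build R (series M R)
  series_scaleA series_scale1 series_scaleDr series_scaleDl.

Fact series_scaleAl (a : R) f g : a *: (f * g) = (a *: f) * g.
Proof.
apply: seriesP => m; transitivity (a * coef (series_mul f g) m) => //.
rewrite [RHS](coef_series_mul (a *: f) g) coef_series_mul big_distrr /=.
by apply: eq_bigr => p _; rewrite mulrA.
Qed.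

HB.instance Definition _ := GRing.Lmodule_isLalgebra.Build R (series M R)
  series_scaleAl.
HB.instance Definition _ := GRing.Lalgebra_isComAlgebra.Build R (series M R).

Definition series_unit : pred (series M R) := fun f => `[< exists g, g * f = 1 >].
Definition series_inv f : series M R :=
  if pselect (exists g, g * f = 1) is left ex then projT1 (cid ex) else f.

Fact series_mulVr : {in series_unit, left_inverse 1 series_inv *%R}.
Proof.
move=> f /asboolP Uf; rewrite /series_inv.
by case: pselect => // ex; case: cid.
Qed.
Fact series_unitPl f g : g * f = 1 -> series_unit f.
Proof. by move=> gf; apply/asboolP; exists g. Qed.
Fact series_inv_out : {in [predC series_unit], series_inv =1 id}.
Proof.
move=> f /asboolPn NUf; rewrite /series_inv.
by case: pselect.
Qed.

HB.instance Definition _ := GRing.ComNzRing_hasMulInverse.Build (series M R)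
  series_mulVr series_unitPl series_inv_out.

End SeriesRing.

(* The sum of a family of series, coefficient by coefficient. Pitfall: it is
   meaningful only if each coefficient is nonzero for finitely many members of
   the family, since a finitely supported sum defaults to 0 otherwise. *)
Definition ssum (M : expType) (R : comNzRingType) (I : choiceType)
    (A : set I) (F : I -> series M R) : series M R :=
  Series (fun m => \sum_(i \in A) coef (F i) m).

Fact nat_finite_decomp (n : nat) : finite_set [set p : nat * nat | p.1 + p.2 = n].
Proof.
apply: (@sub_finite_set _ _ (`I_n.+1 `*` `I_n.+1)); last first.
  by apply: finite_setX; apply: finite_II.
by move=> [a b] /= <-; rewrite !ltnS leq_addr leq_addl.
Qed.
HB.instance Definition _ := hasFiniteDecomp.Build nat nat_finite_decomp.

(* Exponents of monomials in countably many variables: m i is the exponent of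
   the i-th variable. *)
Definition monom := {fsfun nat -> nat with 0%N}.
HB.instance Definition _ := Choice.on monom.

Section Monom.
Local Open Scope fset_scope.
Implicit Types m n : monom.

Definition monom_zero : monom := [fsfun].
Definition monom_add m n : monom :=
  [fsfun i in finsupp m `|` finsupp n => (m i + n i)%N].
Definition monom_var (i : nat) : monom := [fsfun j in [fset i] => 1%N].

Fact monom_addE m n i : monom_add m n i = (m i + n i)%N.
Proof.
by rewrite fsfunE in_fsetU; case: ifPn => // /norP[/fsfun_dflt -> /fsfun_dflt ->].
Qed.
Fact monom_addA : associative monom_add.
Proof. by move=> m n p; apply/fsfunP => i; rewrite !monom_addE addnA. Qed.
Fact monom_addC : commutative monom_add.
Proof. by move=> m n; apply/fsfunP => i; rewrite !monom_addE addnC. Qed.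
Fact monom_add0 : left_id monom_zero monom_add.
Proof. by move=> m; apply/fsfunP => i; rewrite monom_addE fsfunE add0n. Qed.
End Monom.

HB.instance Definition _ :=
  GRing.isNmodule.Build monom monom_addA monom_addC monom_add0.

Fact monom_finite_decomp (m : monom) :
  finite_set [set p : monom * monom | p.1 + p.2 = m].
Proof.
pose N := (\max_(i <- finsupp m) m i).+1.
pose T : finType := {ffun finsupp m -> 'I_N}.
pose h (g : T) : monom := [fsfun i : finsupp m => nat_of_ord (g i)].
have finh : finite_set (range h).
  by apply: finite_image; apply: finite_finset.
apply: (sub_finite_set _ (finite_setX finh finh)).
suff mem (a b : monom) : a + b = m -> range h a.
  move=> [a b] /= ab; split; first exact: mem ab.
  by apply: (mem b a); rewrite addrC.
move=> ab; have le_a i : (a i <= m i)%N by rewrite -ab monom_addE leq_addr.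
have ltN (i : finsupp m) : (a (val i) < N)%N.
  rewrite ltnS (leq_trans (le_a _)) //.
  by apply: leq_bigmax_seq => //; exact: valP.
exists [ffun i => Ordinal (ltN i)] => //; apply/fsfunP => i.
rewrite fsfun_ffun; case: insubP => [j _ <-|/=]; first by rewrite /= ffunE.
by move=> mi; have := le_a i; rewrite (fsfun_dflt mi) leqn0 => /eqP.
Qed.
HB.instance Definition _ := hasFiniteDecomp.Build monom monom_finite_decomp.

(* The ring Q[[x_0, x_1, ...]] containing the symmetric functions over Q; colors
   and variables are numbered from 0 instead of from 1. *)
Definition xseries := series monom rat.
HB.instance Definition _ := GRing.ComUnitRing.on xseries.
HB.instance Definition _ := GRing.ComAlgebra.on xseries.

Definition xvar (i : nat) : xseries := Series (fun m => (m == monom_var i)%:R).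

Definition elemsym (n : nat) : xseries :=
  ssum [set A : {fset nat} | #|` A|%fset = n]
       (fun A => \prod_(i <- enum_fset A) xvar i).

Definition is_partition (l : seq nat) : bool := sorted geq l && (0%N \notin l).

Definition elemsym_part (l : seq nat) : xseries := \prod_(i <- l) elemsym i.

Definition is_e_expansion (f : xseries) (c : {fsfun seq nat -> rat with 0}) :=
  (forall l, l \in finsupp c -> is_partition l) /\
  f = \sum_(l <- enum_fset (finsupp c)) c l *: elemsym_part l.

Definition e_positive (f : xseries) : Prop :=
  exists2 c, is_e_expansion f c & forall l, 0 <= c l.

Record sgraph := SGraph {
  vertex : finType;
  adj : rel vertex;
  adj_sym : symmetric adj;
  adj_irr : irreflexive adj
}.

Definition proper_coloring (H : sgraph) (k : {ffun vertex H -> nat}) : Prop :=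
  forall u w, @adj H u w -> k u <> k w.

Definition chromatic (H : sgraph) : xseries :=
  ssum [set k | @proper_coloring H k] (fun k => \prod_(u : vertex H) xvar (k u)).

Definition path_adj (n : nat) : rel 'I_n :=
  fun i j => (i.+1 == j :> nat) || (j.+1 == i :> nat).
Fact path_adj_sym n : symmetric (@path_adj n).
Proof. by move=> i j; rewrite /path_adj orbC. Qed.
Fact path_adj_irr n : irreflexive (@path_adj n).
Proof. by move=> i; rewrite /path_adj orbb gtn_eqF. Qed.
Definition path_graph (n : nat) : sgraph :=
  SGraph (@path_adj_sym n) (@path_adj_irr n).

Definition is_end_vertex (n : nat) (v : 'I_n) : bool :=
  (v == 0 :> nat) || (v.+1 == n :> nat).

(* [None] is the new vertex v' and [Some u] is the old vertex u. *)
Definition twin_adj (H : sgraph) (v : vertex H) : rel (option (vertex H)) :=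
  fun a b => match a, b with
  | Some u, Some w => adj u w
  | Some u, None | None, Some u => (u == v) || adj v u
  | None, None => false
  end.
Fact twin_adj_sym H v : symmetric (@twin_adj H v).
Proof. by move=> [u|] [w|] //=; rewrite adj_sym. Qed.
Fact twin_adj_irr H v : irreflexive (@twin_adj H v).
Proof. by move=> [u|] //=; rewrite adj_irr. Qed.
Definition twin (H : sgraph) (v : vertex H) : sgraph :=
  SGraph (@twin_adj_sym H v) (@twin_adj_irr H v).

Definition zseries := series nat xseries.
HB.instance Definition _ := GRing.ComUnitRing.on zseries.
HB.instance Definition _ := GRing.ComAlgebra.on zseries.

Definition zvar : zseries := Series (fun n => (n == 1%N)%:R).

(* The series \sum_(i >= k) a_i z^i. *)
Definition zseries_from (k : nat) (a : nat -> xseries) : zseries :=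
  Series (fun i => if (k <= i)%N then a i else 0).

Definition ze_positive (F : zseries) : Prop := forall n, e_positive (coef F n).

Definition path_gf : zseries := zseries_from 0 (fun n => chromatic (path_graph n)).
Definition K_gf : zseries := zseries_from 2 (fun i => i%:R * elemsym i).
Definition G_ge (k : nat) : zseries := zseries_from k (fun i => (i%:R - 1) * elemsym i).
Definition G_gf : zseries := G_ge 2.
Definition D_gf : zseries := 1 - G_gf.

(* \sum_(n >= 1) X_(P_(n,v)) z^(n+1); [v n] is the chosen vertex of P_(n+1),
   so the summand for P_(n+1) contributes the coefficient of z^(n+2). *)
Definition twinned_path_gf (v : forall n, 'I_n.+1) : zseries :=
  Series (fun k => if k is n.+2 then chromatic (@twin (path_graph n.+1) (v n))
                   else 0).

Lemma coef_zmul_lt (f g : zseries) n k :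
  (forall i, (i < n)%N -> coef f i = 0) -> (forall i, (i < k)%N -> coef g i = 0) ->
  forall i, (i < n + k)%N -> coef (f * g) i = 0.
Proof.
move=> f0 g0 i lti; rewrite [LHS](coef_series_mul f g) big_seq big1 // => -[a b].
rewrite mem_decomp /= => /eqP ab.
have [/f0-> | lena] := ltnP a n; first by rewrite mul0r.
have [/g0-> | lekb] := ltnP b k; first by rewrite mulr0.
by move: lti; rewrite -ab ltnNge leq_add.
Qed.

Lemma zseries_unit (f : zseries) : coef f 0%N = 1 -> f \is a GRing.unit.
Proof.
move=> f0; pose u : zseries := 1 - f.
have u0 i : (i < 1)%N -> coef u i = 0.
  by case: i => // _; rewrite /= f0 subrr.
have uk k i : (i < k)%N -> coef (u ^+ k) i = 0.
  elim: k i => // k IH i; rewrite exprS -addn1 addnC.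
  exact: (coef_zmul_lt u0 IH).
pose g : zseries := Series (fun n => coef (\sum_(k < n.+1) u ^+ k) n).
have coefD (a b : zseries) i : coef (a + b) i = coef a i + coef b i by [].
have coefB (a b : zseries) i : coef (a - b) i = coef a i - coef b i by [].
have coefS n (a : nat -> zseries) i :
    coef (\sum_(k < n) a k) i = \sum_(k < n) coef (a k) i.
  by elim: n => [|n IH]; rewrite ?big_ord0 // !big_ord_recr /= -IH.
have gE n i : (i <= n)%N -> coef g i = coef (\sum_(k < n.+1) u ^+ k) i.
  move=> lein; rewrite [LHS]/= !coefS.
  rewrite (@big_ord_widen _ _ _ i.+1 n.+1 (fun k => coef (u ^+ k) i)) //.
  rewrite big_mkcond; apply: eq_bigr => k _.
  by case: ltnP => // ltik; rewrite uk.
apply/unitrP; exists g; suff gf : g * f = 1 by split; rewrite // mulrC.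
apply: seriesP => n; set s : zseries := \sum_(k < n.+1) u ^+ k.
have sf : s * f = 1 - u ^+ n.+1.
  have -> : f = 1 - u by rewrite opprB addrC subrK.
  by rewrite mulrC -[1 in RHS](expr1n _ n.+1) subrXX; congr (_ * _);
     apply: eq_bigr => k _; rewrite expr1n mul1r.
have -> : coef (g * f) n = coef (s * f) n.
  rewrite [LHS](coef_series_mul g f) [RHS](coef_series_mul s f).
  rewrite big_seq [RHS]big_seq; apply: eq_bigr => -[a b].
  rewrite mem_decomp /= => /eqP ab; congr (_ * _).
  by apply: gE; rewrite -ab leq_addr.
by rewrite sf coefB uk ?subr0.
Qed.

Lemma D_gf_unit : D_gf \is a GRing.unit.
Proof. by apply: zseries_unit; rewrite /= subr0. Qed.

(* The sums defining [elemsym] and [chromatic] are locally finite. *)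
Lemma coef_prod_xvar (I : Type) (r : seq I) (k : I -> nat) (m : monom) :
  coef (\prod_(u <- r) xvar (k u)) m = (m == \sum_(u <- r) monom_var (k u))%:R.
Proof.
elim: r m => [|u r IH] m; first by rewrite !big_nil.
rewrite !big_cons; set p := \prod_(_ <- _) _; set s := \sum_(_ <- _) _.
rewrite [LHS](coef_series_mul (xvar (k u)) p).
case: eqP => [->|neq].
  rewrite (bigD1_seq (monom_var (k u), s)) ?decomp_uniq ?mem_decomp //=.
  rewrite IH !eqxx mul1r big1_seq ?addr0 // => -[a b] /=; rewrite IH.
  move=> /andP[]; rewrite mem_decomp xpair_eqE /=.
  by case: eqP => [->|_]; case: eqP => [->|_] //; rewrite ?mulr0 ?mul0r.
rewrite big1_seq // => -[a b] /=; rewrite mem_decomp IH /= => /eqP ab.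
case: eqP => [ea|_]; case: eqP => [eb|_]; rewrite ?mulr0 ?mul0r //.
by case: neq; rewrite -ab ea eb.
Qed.

Lemma finsupp_sum_var (I : eqType) (r : seq I) (k : I -> nat) (u : I) :
  u \in r -> k u \in finsupp (\sum_(w <- r) monom_var (k w) : monom).
Proof.
move=> ur; rewrite mem_finsupp (big_rem u) //= monom_addE fsfunE inE eqxx.
by rewrite addn_eq0.
Qed.

Lemma chromatic_finite_support (H : sgraph) (m : monom) :
  finite_set [set k : {ffun vertex H -> nat} |
                coef (\prod_(u : vertex H) xvar (k u)) m != 0].
Proof.
pose T : finType := {ffun vertex H -> finsupp m}.
pose h (g : T) : {ffun vertex H -> nat} := [ffun u => val (g u)].
have finh : finite_set (range h).
  by apply: finite_image; apply: finite_finset.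
apply: (sub_finite_set _ finh) => k /=.
rewrite coef_prod_xvar; case: (m =P _) => [mE _|_]; last by rewrite eqxx.
have km u : k u \in finsupp m by rewrite mE finsupp_sum_var ?mem_index_enum.
by exists [ffun u => [` km u]%fset] => //; apply/ffunP => u; rewrite !ffunE.
Qed.

Lemma elemsym_finite_support (m : monom) :
  finite_set [set A : {fset nat} |
                coef (\prod_(i <- enum_fset A) xvar i) m != 0].
Proof.
apply: (sub_finite_set _ (finite_fset (fpowerset (finsupp m)))) => A /=.
rewrite (coef_prod_xvar _ id); case: (m =P _) => [mE _|_]; last by rewrite eqxx.
rewrite fpowersetE; apply/fsubsetP => i iA; rewrite mE.
exact: (@finsupp_sum_var _ _ id).
Qed.

(* Main.v *)
(** Sending the variables of index [>= N] to 0 reduces every identity to finitely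
    many colors. There, let [W_c] be the generating function of the properly
    colored paths whose first vertex has color [c]. Prepending [c] to any path
    not starting with [c] gives [W_c (1 + x_c z) = x_c z X], where [X] is the
    path generating function, and [X = 1 + \sum_c W_c]. Multiplying by
    [E = \prod_c (1 + x_c z) = \sum_i e_i z^i] yields [E (X - 1) = (z E') X],
    that is [X D = E].

    Twinning a leaf creates a triangle [v, v', w]. As [v <> v'], the color of [w]
    differs from at least one of those of [v] and [v'], so by inclusion-exclusion
    [X_(P_(n+1,v)) = 2 X_(P_(n+2)) - 2 e_2 X_(P_n)]. The two formulas of the
    theorem follow by algebra, and positivity from [X = X G + E]. *)

Require Import Defs.
From mathcomp Require Import all_boot all_order all_algebra finmap.
From mathcomp Require Import boolp classical_sets fsbigop.
From mathcomp Require Import zify ring.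

Set Implicit Arguments.
Unset Strict Implicit.
Unset Printing Implicit Defensive.

Import Order.TTheory GRing.Theory Num.Theory.

Local Open Scope ring_scope.

(** * Finite sums over tuples and of power series *)

Lemma sum_tuple0 (R : nmodType) (T : finType) (F : seq T -> R) :
  \sum_(t : 0.-tuple T) F t = F [::].
Proof.
rewrite (eq_bigr (fun=> F [::])) => [|t _]; last by rewrite tuple0.
by rewrite big_const cardT -cardE card_tuple expn0 /= addr0.
Qed.

Lemma sum_tuple_cons (R : nmodType) (T : finType) n (F : seq T -> R) :
  \sum_(t : n.+1.-tuple T) F t = \sum_(c : T) \sum_(t : n.-tuple T) F (c :: t).
Proof.
rewrite pair_big /= (reindex (fun p : T * n.-tuple T => cons_tuple p.1 p.2)) //=.
exists (fun t => (thead t, behead_tuple t)) => [[c t] _|t _] /=.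
  by congr pair; apply: val_inj.
by rewrite [RHS]tuple_eta; apply: val_inj.
Qed.

Lemma coef_series_sum (M : expType) (R : comNzRingType) (I : Type) (r : seq I)
    (P : pred I) (F : I -> series M R) (m : M) :
  coef (\sum_(i <- r | P i) F i) m = \sum_(i <- r | P i) coef (F i) m.
Proof. exact: (big_morph (fun f : series M R => coef f m)). Qed.

(** * Equality of series in the first [N] variables *)

Section Truncation.
Variable N : nat.

(** Encodes equality in the quotient where the variables of index [>= N] vanish, without building
    that quotient. *)
Definition agree (f g : xseries) : Prop :=
  forall m : monom, (forall i, (N <= i)%N -> m i = 0%N) -> coef f m = coef g m.

Definition zagree (F G : zseries) : Prop := forall n, agree (coef F n) (coef G n).

Lemma agreeD f f' g g' : agree f f' -> agree g g' -> agree (f + g) (f' + g').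
Proof. by move=> ff' gg' m mN; congr (_ + _); [apply: ff' | apply: gg']. Qed.

Lemma agreeN f f' : agree f f' -> agree (- f) (- f').
Proof. by move=> ff' m mN; congr (- _); apply: ff'. Qed.

(** Both factors of a monomial in the first [N] variables again involve only these variables. *)
Lemma agreeM f f' g g' : agree f f' -> agree g g' -> agree (f * g) (f' * g').
Proof.
move=> ff' gg' m mN; rewrite [LHS](coef_series_mul f g) [RHS](coef_series_mul f' g').
rewrite big_seq [RHS]big_seq; apply: eq_bigr => -[a b].
rewrite mem_decomp /= => /eqP abm.
have ab0 i : (N <= i)%N -> a i = 0%N /\ b i = 0%N.
  by move=> /mN /eqP; rewrite -abm monom_addE addn_eq0 => /andP[/eqP-> /eqP->].
by congr (_ * _); [apply: ff' | apply: gg'] => i /ab0[].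
Qed.

Lemma agree_sum (I : Type) (r : seq I) (P : pred I) (F G : I -> xseries) :
  (forall i, P i -> agree (F i) (G i)) ->
  agree (\sum_(i <- r | P i) F i) (\sum_(i <- r | P i) G i).
Proof. by move=> FG; apply: (big_ind2 agree) => //; exact: agreeD. Qed.

Lemma zagreeM F F' G G' : zagree F F' -> zagree G G' -> zagree (F * G) (F' * G').
Proof.
move=> FF' GG' n m mN.
rewrite [coef (F * G) n](coef_series_mul F G).
rewrite [coef (F' * G') n](coef_series_mul F' G').
apply: agree_sum mN => p _; apply: agreeM; [exact: FF' | exact: GG'].
Qed.

(** The last hypothesis puts every index that contributes to [m] in the image of [h]. Hence the
    support is finite and the default value 0 of an infinite sum does not interfere. *)
Lemma coef_ssum_fin (I : choiceType) (J : finType) (h : J -> I) (A : set I)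
    (P : pred J) (F : I -> xseries) (m : monom) :
  injective h -> (forall j, A (h j) <-> P j) ->
  (forall i, A i -> coef (F i) m != 0 -> exists j, h j = i) ->
  coef (ssum A F) m = coef (\sum_(j | P j) F (h j)) m.
Proof.
move=> inj_h AP Fh; rewrite coef_series_sum /=.
rewrite (fsbigE [seq h j | j <- enum P]).
- rewrite big_map big_enum_cond; apply: eq_bigl => j.
  apply/andP/idP => [[]//|Pj]; split=> //; rewrite in_setE; exact/AP.
- by rewrite map_inj_uniq ?enum_uniq.
- by move=> _ /= /mapP[j + ->]; rewrite mem_enum => /AP.
move=> i Ai; apply: contraNeq => /(Fh _ Ai)[j hj].
by rewrite -hj mem_map // mem_enum; apply/AP; rewrite hj.
Qed.

End Truncation.

(** Each monomial involves finitely many variables, so it is seen for some [N]. *)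
Lemma agreeP f g : (forall N, agree N f g) -> f = g.
Proof.
move=> fg; apply: seriesP => m.
apply: (fg (\max_(i <- finsupp m) i).+1) => i; rewrite ltnNge; apply: contraNeq.
by rewrite -mem_finsupp => im; exact: (@leq_bigmax_seq _ _ xpredT id).
Qed.

Lemma zagreeP F G : (forall N, zagree N F G) -> F = G.
Proof. by move=> FG; apply: seriesP => n; apply: agreeP => N; apply: FG. Qed.

(** The Euler operator z d/dz, a derivation that preserves degrees; applied to E it gives z E'. *)
Definition theta (F : zseries) : zseries := Series (fun n => n%:R * coef F n).

Lemma thetaM F G : theta (F * G) = theta F * G + F * theta G.
Proof.
apply: seriesP => n; transitivity (n%:R * coef (F * G) n) => //.
rewrite [coef (F * G) n](coef_series_mul F G).
transitivity (coef (theta F * G) n + coef (F * theta G) n) => //.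
rewrite [coef (theta F * G) n](coef_series_mul (theta F) G).
rewrite [coef (F * theta G) n](coef_series_mul F (theta G)).
rewrite big_distrr -big_split /= big_seq [RHS]big_seq; apply: eq_bigr => -[a b].
rewrite mem_decomp /= => /eqP <-; rewrite natrD; ring.
Qed.

Lemma zagree_theta N F G : zagree N F G -> zagree N (theta F) (theta G).
Proof. by move=> FG n; apply: agreeM => //; apply: FG. Qed.

(** * Words without equal neighbors, over an alphabet of [N] colors *)

Section Words.
Variable N : nat.
Implicit Types (a b c d : 'I_N) (n : nat).

Definition neq_rel : rel 'I_N := fun a b => a != b.

Definition weight (s : seq 'I_N) : xseries := \prod_(c <- s) xvar c.

Definition word_sum n : xseries :=
  \sum_(t : n.-tuple 'I_N | sorted neq_rel t) weight t.

(** The letter [c] acts only as predecessor of the word; its variable is not part of the weight. *)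
Definition tail_sum c n : xseries :=
  \sum_(t : n.-tuple 'I_N | path neq_rel c t) weight t.

Lemma word_sumE n : word_sum n =
  \sum_(t : n.-tuple 'I_N) (if sorted neq_rel t then weight t else 0).
Proof. exact: big_mkcond. Qed.

Lemma tail_sumE c n : tail_sum c n =
  \sum_(t : n.-tuple 'I_N) (if path neq_rel c t then weight t else 0).
Proof. exact: big_mkcond. Qed.

Lemma word_sum0 : word_sum 0 = 1.
Proof.
rewrite word_sumE.
rewrite (sum_tuple0 (fun s => if sorted neq_rel s then weight s else 0)).
by rewrite /weight big_nil.
Qed.

Lemma tail_sum0 c : tail_sum c 0 = 1.
Proof.
rewrite tail_sumE.
rewrite (sum_tuple0 (fun s => if path neq_rel c s then weight s else 0)).
by rewrite /weight big_nil.
Qed.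

Lemma word_sumS n : word_sum n.+1 = \sum_(c : 'I_N) xvar c * tail_sum c n.
Proof.
rewrite word_sumE.
rewrite (sum_tuple_cons _ (fun s => if sorted neq_rel s then weight s else 0)).
apply: eq_bigr => c _; rewrite tail_sumE big_distrr; apply: eq_bigr => t _ /=.
by rewrite /weight big_cons; case: ifP; rewrite ?mulr0.
Qed.

Lemma tail_sumS c n : tail_sum c n.+1 = \sum_(d | c != d) xvar d * tail_sum d n.
Proof.
rewrite tail_sumE.
rewrite (sum_tuple_cons _ (fun s => if path neq_rel c s then weight s else 0)).
rewrite [RHS]big_mkcond; apply: eq_bigr => d _.
case: (boolP (c != d)) => cd; last first.
  by apply: big1 => t _ /=; rewrite /neq_rel (negbTE cd).
rewrite tail_sumE big_distrr; apply: eq_bigr => t _ /=.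
by rewrite {1}/neq_rel cd /weight big_cons /=; case: ifP => _; rewrite ?mulr0.
Qed.

(** A nonempty proper word either starts with [c] or may be preceded by [c]. *)
Lemma word_sum_tail_sum c n :
  word_sum n.+1 = xvar c * tail_sum c n + tail_sum c n.+1.
Proof.
rewrite word_sumS tail_sumS (bigD1 c) //=; apply: congr1.
by apply: eq_bigl => d; rewrite eq_sym.
Qed.

(** These three series are X, W_c and E for [N] colors. *)
Definition words_gf : zseries := zseries_from 0 word_sum.
Definition words_from_gf c : zseries :=
  Series (fun n => if n is k.+1 then xvar c * tail_sum c k else 0).
Definition elem_gf : zseries := \prod_(c : 'I_N) (1 + xvar c *: zvar).

Lemma words_gfE : words_gf = 1 + \sum_(c : 'I_N) words_from_gf c.
Proof.
apply: seriesP => n.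
transitivity ((n == 0%N)%:R + coef (\sum_(c : 'I_N) words_from_gf c) n) => //.
rewrite coef_series_sum; case: n => [|n] /=; first by rewrite word_sum0 big1 ?addr0.
by rewrite word_sumS add0r.
Qed.

Lemma coef_zvarM (F : zseries) n :
  coef (zvar * F) n = if n is k.+1 then coef F k else 0.
Proof.
rewrite [LHS](coef_series_mul zvar F); case: n => [|n].
  rewrite big_seq big1 // => -[a b]; rewrite mem_decomp /= addn_eq0.
  by case/andP=> /eqP-> _; rewrite mul0r.
rewrite (bigD1_seq (1%N, n)) ?mem_decomp ?decomp_uniq ?add1n //= mul1r.
rewrite big_seq_cond big1 ?addr0 // => -[a b] /andP[]; rewrite mem_decomp /=.
case: (a =P 1%N) => [->|_ _ _]; last by rewrite mul0r.
by rewrite xpair_eqE /= => /eqP bn; have [->] : b.+1 = n.+1 := bn; rewrite eqxx.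
Qed.

Lemma coef_zvarX k n : coef (zvar ^+ k) n = (n == k)%:R.
Proof.
elim: k n => [|k IHk] n; first by [].
by rewrite exprS coef_zvarM; case: n => // n; rewrite IHk.
Qed.

Lemma words_from_gfE c :
  words_from_gf c * (1 + xvar c *: zvar) = (xvar c *: zvar) * words_gf.
Proof.
rewrite mulrDr mulr1 -scalerAr -scalerAl [_ * zvar]mulrC; apply: seriesP => n.
transitivity (coef (words_from_gf c) n + xvar c * coef (zvar * words_from_gf c) n) => //.
transitivity (xvar c * coef (zvar * words_gf) n) => //.
(* Degrees 0 and 1 are separate because the empty word may follow every letter; from degree 2 on,
   the words are split by whether they start with [c]. *)
rewrite !coef_zvarM; case: n => [|[|n]] /=; first by rewrite mulr0 addr0.
  by rewrite tail_sum0 word_sum0 mulr0 addr0.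
by rewrite (word_sum_tail_sum c) mulrDr addrC.
Qed.

Lemma theta_linear c : theta (1 + xvar c *: zvar) = xvar c *: zvar.
Proof.
apply: seriesP => n.
have theta1 (R : comNzRingType) (x : R) :
    n%:R * ((n == 0%N)%:R + x * (n == 1%N)%:R) = x * (n == 1%N)%:R.
  by case: n => [|[|n]]; rewrite /= ?mul0r ?mulr0 ?add0r ?mulr0 ?mul1r.
exact: theta1.
Qed.

(** Since X - 1 is the sum of the W_c, the relation for W_c replaces the factor [1 + x_c z] of E by
    its Euler derivative [x_c z], and the product rule collects these terms. An induction over the
    colors avoids dividing by the factors. *)
Lemma elem_gf_words_gf : elem_gf * (words_gf - 1) = theta elem_gf * words_gf.
Proof.
rewrite words_gfE addrAC subrr add0r -words_gfE /elem_gf.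
(* Only the product E and the sum of the W_c shrink in this induction; [words_gf] keeps all [N]
   colors. *)
elim: (index_enum _) => [|c r IHr].
  rewrite !big_nil mulr0; apply/esym/seriesP => n.
  rewrite [LHS](coef_series_mul (theta 1) words_gf) big1 // => -[a b] _.
  by case: a => [|a] /=; rewrite ?mulr0 !mul0r.
rewrite !big_cons thetaM theta_linear.
set E := \prod_(_ <- r) _ in IHr *; set S := \sum_(_ <- r) _ in IHr *.
transitivity (E * (words_from_gf c * (1 + xvar c *: zvar)) +
              (1 + xvar c *: zvar) * (E * S)); first by ring.
rewrite IHr words_from_gfE; ring.
Qed.

(* A set of colors is encoded by its indicator function. *)
Lemma coef_elem_gf n : coef elem_gf n =
  \sum_(f : {ffun 'I_N -> bool} | (\sum_c (f c : nat))%N == n) \prod_(c | f c) xvar c.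
Proof.
pose T (c : 'I_N) (b : bool) : zseries := if b then xvar c *: zvar else 1.
have -> : elem_gf = \prod_(c : 'I_N) \sum_(b : bool) T c b.
  by apply: eq_bigr => c _; rewrite big_bool /= addrC.
rewrite bigA_distr_bigA coef_series_sum [RHS]big_mkcond; apply: eq_bigr => f _.
have -> : \prod_c T c (f c) =
    (\prod_(c | f c) xvar c) *: zvar ^+ (\sum_c (f c : nat))%N.
  rewrite [in RHS]big_mkcond /=.
  elim: (index_enum _) => [|c r IHr]; first by rewrite !big_nil expr0 scale1r.
  rewrite !big_cons IHr /T; case: (f c) => /=; last by rewrite !mul1r.
  by rewrite add1n exprS -scalerAl -scalerAr scalerA.
transitivity ((\prod_(c | f c) xvar c) * coef (zvar ^+ (\sum_c (f c : nat))%N) n) => //.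
by rewrite coef_zvarX eq_sym; case: eqP; rewrite ?mulr1 ?mulr0.
Qed.

(** * Elementary and chromatic symmetric functions as finite sums *)

(** Sets of colors below [N] correspond to indicator functions. A set with an element [>= N] yields
    a monomial excluded by [mN], so it does not contribute. *)
Lemma agree_elemsym n : agree N (elemsym n) (coef elem_gf n).
Proof.
move=> m mN; rewrite coef_elem_gf.
pose r (f : {ffun 'I_N -> bool}) := [seq nat_of_ord c | c <- enum 'I_N & f c].
have r_uniq f : uniq (r f).
  by rewrite (map_inj_uniq (@ord_inj N)) filter_uniq ?enum_uniq.
have mem_r f (c : 'I_N) : (nat_of_ord c \in r f) = f c.
  by rewrite (mem_map (@ord_inj N)) mem_filter mem_enum andbT.
pose h f : {fset nat} := seq_fset tt (r f).
have prod_h f : \prod_(i <- enum_fset (h f)) xvar i = \prod_(c | f c) xvar c.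
  rewrite (perm_big (r f)); last first.
    by have := seq_fset_perm tt (r f); rewrite undup_id.
  by rewrite big_map big_filter big_enum_cond.
rewrite -(eq_bigr _ (fun f _ => prod_h f)).
apply: (@coef_ssum_fin _ _ h _ _ (fun A => \prod_(i <- enum_fset A) xvar i)).
- move=> f g /fsetP fg; apply/ffunP => c.
  by have := fg c; rewrite !seq_fsetE !mem_r.
- move=> f; have -> : (\sum_c (f c : nat))%N = #|` h f|%fset.
    rewrite size_seq_fset undup_id // size_map size_filter.
    rewrite -sum1_count [RHS]big_mkcond big_enum /=.
    by apply: eq_bigr => c _; case: (f c).
  by split=> [-> //|/eqP].
move=> A _; rewrite (coef_prod_xvar _ id); case: (m =P _) => [mE _|_];
  last by rewrite eqxx.
exists [ffun c => nat_of_ord c \in A]; apply/fsetP => i; rewrite seq_fsetE.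
have [ltiN|leNi] := ltnP i N; first by rewrite (mem_r _ (Ordinal ltiN)) ffunE.
transitivity false.
  by apply/mapP => -[c _ ic]; move: leNi; rewrite ic leqNgt ltn_ord.
apply/esym/negbTE/negP => iA.
have := @finsupp_sum_var _ (enum_fset A) id i iA.
by rewrite -mE mem_finsupp mN // eqxx.
Qed.

(** The encoding [J] of colorings stays abstract: tuples serve for paths, pairs of a color and a
    tuple for twinned paths. *)
Lemma agree_chromatic (H : sgraph) (J : finType) (h : J -> vertex H -> 'I_N)
    (P : pred J) :
  (forall i j, h i =1 h j -> i = j) ->
  (forall k : vertex H -> 'I_N, exists j, h j =1 k) ->
  (forall j, reflect (forall u w, adj u w -> h j u != h j w) (P j)) ->
  agree N (chromatic H) (\sum_(j | P j) \prod_u xvar (h j u)).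
Proof.
move=> inj_h surj_h properP m mN.
pose h' j : {ffun vertex H -> nat} := [ffun u => val (h j u)].
have prod_h j : \prod_u xvar (h' j u) = \prod_u xvar (h j u).
  by apply: eq_bigr => u _; rewrite ffunE.
rewrite -(eq_bigr _ (fun j _ => prod_h j)).
apply: (@coef_ssum_fin _ _ h' _ _ (fun k => \prod_u xvar (k u))).
- move=> i j /ffunP ij; apply: inj_h => u; apply: val_inj.
  by have := ij u; rewrite !ffunE.
- move=> j; split=> [pr|/properP pr u w /pr].
    by apply/properP => u w /pr; rewrite !ffunE => /eqP.
  by rewrite !ffunE => /eqP + /val_inj.
move=> k _; rewrite coef_prod_xvar; case: (m =P _) => [mE _|_]; last by rewrite eqxx.
(* Every color used by [k] has a positive exponent in [m], which only involves variables below
   [N]. *)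
have ltN u : (k u < N)%N.
  rewrite ltnNge; apply/negP => /mN ku0.
  have : k u \in finsupp m by rewrite mE finsupp_sum_var ?mem_index_enum.
  by rewrite mem_finsupp ku0.
have [j hj] := surj_h (fun u => Ordinal (ltN u)).
by exists j; apply/ffunP => u; rewrite ffunE hj.
Qed.

End Words.

(** * Colorings of paths and of twinned paths as words *)

Lemma prod_option (R : comNzRingType) (T : finType) (F : option T -> R) :
  \prod_u F u = F None * \prod_(u : T) F (Some u).
Proof.
rewrite (bigD1 None) //=; congr (_ * _).
rewrite (reindex_omap Some id) /=; last by case.
by apply: eq_bigl => u; rewrite eqxx.
Qed.

Section Graphs.
Variable N : nat.
Implicit Types (a b c d : 'I_N) (n : nat).
Local Notation neq_rel := (@neq_rel N).

Lemma sorted_neqP n (t : n.-tuple 'I_N) :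
  reflect (forall i j : 'I_n, path_adj i j -> tnth t i != tnth t j) (sorted neq_rel t).
Proof.
case: n t => [t|n t]; first by rewrite tuple0; constructor; case.
apply: (iffP (sortedP (thead t))) => [st i j|st i]; last first.
  rewrite size_tuple => lt_i; have lt_i' := ltnW lt_i.
  have := st (Ordinal lt_i') (Ordinal lt_i).
  by rewrite /path_adj /= eqxx !(tnth_nth (thead t)) => /(_ isT).
rewrite !(tnth_nth (thead t)) => /orP[] /eqP ij; last rewrite eq_sym.
  by have := st i; rewrite ij size_tuple ltn_ord => /(_ isT).
by have := st j; rewrite ij size_tuple ltn_ord => /(_ isT).
Qed.

(** Vertex 0 has at most the neighbor 1. Once [t] is proper, the comparison with [a] therefore
    concerns only the first letter of [behead t]. *)
Lemma path_neqP n a (t : n.+1.-tuple 'I_N) : sorted neq_rel t ->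
  reflect (forall j : 'I_n.+1, path_adj ord0 j -> a != tnth t j)
          (path neq_rel a (behead t)).
Proof.
case: n t => [|n] t st.
  have -> : behead t = [::] by apply: size0nil; rewrite size_behead size_tuple.
  by constructor=> -[[|j] ltj].
case: t st => -[|b [|c s]] //= tP /andP[_ ->]; rewrite andbT.
apply: (iffP idP) => [ac j|aj]; last first.
  by have := aj (inord 1); rewrite (tnth_nth a) /path_adj inordK //= => /(_ isT).
by rewrite /path_adj orbF (tnth_nth a) => /eqP <-.
Qed.

Lemma agree_path n : agree N (chromatic (path_graph n)) (word_sum N n).
Proof.
have -> : word_sum N n =
    \sum_(t : n.-tuple 'I_N | sorted neq_rel t) \prod_(i < n) xvar (tnth t i).
  by apply: eq_bigr => t _; rewrite /weight big_tuple.
apply: (@agree_chromatic N (path_graph n) _ (fun t => tnth t)).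
- by move=> s t /eq_from_tnth.
- by move=> k; exists [tuple k i | i < n] => i; rewrite tnth_mktuple.
by move=> t; apply: sorted_neqP.
Qed.

Definition avoid_sum a b n : xseries :=
  \sum_(t : n.-tuple 'I_N | path neq_rel a t && path neq_rel b t) weight t.

Definition pair_weight a b : xseries := if a != b then xvar a * xvar b else 0.

(** Here [a] is the color of v', [b] that of the leaf, and the word of length [n] colors the rest of
    the path; [pair_weight] accounts for the edge between v and v'. *)
Definition twin_sum n : xseries :=
  \sum_(a : 'I_N) \sum_(b : 'I_N) pair_weight a b * avoid_sum a b n.

Lemma pair_weightC a b : pair_weight a b = pair_weight b a.
Proof. by rewrite /pair_weight (eq_sym a b); case: (b != a); [exact: mulrC | by []]. Qed.

Lemma word_sumSS n : word_sum N n.+2 =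
  \sum_(a : 'I_N) \sum_(b : 'I_N) pair_weight a b * tail_sum b n.
Proof.
rewrite word_sumS; apply: eq_bigr => a _.
rewrite tail_sumS big_distrr big_mkcond; apply: eq_bigr => b _.
by rewrite /pair_weight; case: (a != b); rewrite /= ?mul0r ?mulrA.
Qed.

(* At most one of the two distinct colors is the first letter of a word, so at
   least one of the two path conditions amounts to properness of the word. *)
Lemma avoid_sumE a b n : a != b ->
  avoid_sum a b n + word_sum N n = tail_sum a n + tail_sum b n.
Proof.
move=> ab; rewrite /avoid_sum big_mkcond word_sumE !tail_sumE -!big_split.
apply: eq_bigr => -[[|c s] /= _] _ //.
have truth_table (R : nmodType) (w : R) (p q r : bool) : p || q ->
    (if [&& p, r & q && r] then w else 0) + (if r then w else 0) =
    (if p && r then w else 0) + (if q && r then w else 0).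
  by case: p q r => [] [] [] //= _; rewrite ?addr0 ?add0r.
rewrite -andbA; apply: truth_table; rewrite /neq_rel.
by apply: contraNT ab; rewrite negb_or !negbK => /andP[/eqP-> /eqP->].
Qed.

(** Multiply [avoid_sumE] by [pair_weight a b] and sum over both colors. As [pair_weight] is
    symmetric, each of the two tail sums yields all words of length [n.+2]; the pair weights alone
    add up to [word_sum N 2]. *)
Lemma twin_sumE n :
  twin_sum n = 2%:R * word_sum N n.+2 - word_sum N 2 * word_sum N n.
Proof.
apply/eqP; rewrite -subr_eq opprK mulr_natl mulr2n; apply/eqP.
rewrite {1}word_sumSS [in LHS]big_distrl /twin_sum -big_split.
have -> : word_sum N n.+2 + word_sum N n.+2 =
  \sum_(a : 'I_N) \sum_(b : 'I_N) pair_weight a b * (tail_sum a n + tail_sum b n).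
  under eq_bigr => a _ do (under eq_bigr => b _ do rewrite mulrDr; rewrite big_split).
  rewrite big_split /= -word_sumSS; congr (_ + _).
  rewrite word_sumSS exchange_big; apply: eq_bigr => a _; apply: eq_bigr => b _.
  by rewrite pair_weightC.
apply: eq_bigr => a _; rewrite big_distrl -big_split; apply: eq_bigr => b _ /=.
rewrite tail_sum0 mulr1 -mulrDr /pair_weight; case: ifP => [ab|]; last by rewrite !mul0r.
by rewrite avoid_sumE.
Qed.

Lemma agree_twin n (v : 'I_n.+1) : is_end_vertex v ->
  agree N (chromatic (@twin (path_graph n.+1) v)) (twin_sum n).
Proof.
move=> end_v.
(* The automorphism [r] of the path moves the leaf to vertex 0: it is the identity or the
   reflection. *)
have [r [rK r_adj r_v]] : exists r : 'I_n.+1 -> 'I_n.+1,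
    [/\ involutive r, forall i j, path_adj (r i) (r j) = path_adj i j & r v = ord0].
  case/orP: end_v => /eqP vE; first by exists id; split=> //; apply: val_inj.
  exists (@rev_ord n.+1); split; first exact: rev_ordK.
    by move=> [i lti] [j ltj]; rewrite /path_adj /=; lia.
  by apply: val_inj; rewrite /= vE subnn.
(* A coloring is a color for v' together with the word read along the path from the leaf. *)
pose h (p : 'I_N * n.+1.-tuple 'I_N) (u : option 'I_n.+1) :=
  if u is Some i then tnth p.2 (r i) else p.1.
pose P (p : 'I_N * n.+1.-tuple 'I_N) :=
  [&& p.1 != tnth p.2 ord0, sorted neq_rel p.2 & path neq_rel p.1 (behead p.2)].
have -> : twin_sum n = \sum_(p | P p) \prod_u xvar (h p u).
  have weightE (t : n.+1.-tuple 'I_N) : weight t = \prod_i xvar (tnth t (r i)).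
    by rewrite /weight big_tuple; exact: (reindex_inj (inv_inj rK)).
  have prodE p : \prod_u xvar (h p u) = xvar p.1 * weight p.2.
    by rewrite prod_option weightE.
  rewrite (eq_bigr _ (fun p _ => prodE p)) [RHS]big_mkcond /=.
  (* The summand is restated on lists so that [sum_tuple_cons] can split off the color of the
     leaf. *)
  pose F a (s : seq 'I_N) :=
    if [&& a != head a s, sorted neq_rel s & path neq_rel a (behead s)]
    then xvar a * weight s else 0.
  transitivity (\sum_a \sum_(t : n.+1.-tuple 'I_N) F a t); last first.
    rewrite pair_big; apply: eq_bigr => -[a t] _ /=.
    by rewrite /F /P /= (tnth_nth a) nth0.
  apply: eq_bigr => a _; rewrite sum_tuple_cons; apply: eq_bigr => b _.
  rewrite /avoid_sum big_distrr big_mkcond; apply: eq_bigr => t _.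
  rewrite /F /pair_weight /= andbC /weight big_cons.
  by case: (a != b); case: (_ && _); rewrite /= ?mul0r // mulrA.
apply: agree_chromatic.
- move=> [a s] [b t] st; congr pair; first exact: (st None).
  by apply: eq_from_tnth => i; have := st (Some (r i)); rewrite /h /= rK.
- move=> k; exists (k None, [tuple k (Some (r i)) | i < n.+1]) => -[i|] //=.
  by rewrite tnth_mktuple rK.
move=> [a t]; apply: (iffP and3P) => /= [[a0 st pt]|pr].
  have at_adj i : (i == v) || path_adj v i -> a != tnth t (r i).
    rewrite -r_adj r_v => /orP[/eqP->|]; first by rewrite r_v.
    exact/path_neqP.
  move=> [i|] [j|] //=.
  + by rewrite -r_adj; apply/sorted_neqP.
  + by move/at_adj; rewrite eq_sym.
  + by move/at_adj.
have st : sorted neq_rel t.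
  apply/sorted_neqP => i j; rewrite -(rK i) -(rK j) r_adj => ij.
  exact: (pr (Some (r i)) (Some (r j))).
split=> //.
  by have := pr None (Some v); rewrite /= eqxx r_v => /(_ isT).
apply/path_neqP => // j; rewrite -r_v -(rK j) r_adj => vj.
by apply: (pr None (Some (r j))); rewrite /= vj orbT.
Qed.

End Graphs.

(** * From finitely many colors to identities of symmetric functions *)

Lemma elemsym0 : elemsym 0 = 1.
Proof.
apply: seriesP => m; rewrite /=.
have -> : [set A : {fset nat} | #|` A|%fset = 0%N]%classic = [set fset0]%classic.
  by apply/seteqP; split=> A /=; [move/cardfs0_eq | move->; rewrite cardfs0].
by rewrite fsbig_set1 big_nil.
Qed.

(** One has D = E - z E', because the coefficient (1 - n) e_n equals 1 for n = 0, vanishes for n = 1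
    and is that of -G from n = 2 on. In [N] colors, E (X - 1) = (z E') X rearranges to X (E - z E')
    = E. *)
Lemma path_gfE : path_gf * D_gf = zseries_from 0 elemsym.
Proof.
pose E := zseries_from 0 elemsym.
have -> : D_gf = E - theta E.
  apply: seriesP => n.
  have coefE (R : comNzRingType) (x : nat -> R) : x 0%N = 1 ->
      (n == 0%N)%:R - (if (2 <= n)%N then (n%:R - 1) * x n else 0) = x n - n%:R * x n.
    by case: n => [|[|n]] /= x0; rewrite ?x0; ring.
  exact: (coefE xseries elemsym elemsym0).
apply: zagreeP => N.
have XN : zagree N path_gf (words_gf N) by move=> n; apply: agree_path.
have EN : zagree N E (elem_gf N) by move=> n; apply: agree_elemsym.
have step : zagree N (path_gf * (E - theta E))
    (words_gf N * (elem_gf N - theta (elem_gf N))).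
  apply: zagreeM => // n; apply: agreeD; first exact: EN.
  by apply/agreeN/(zagree_theta EN).
have eqN : words_gf N * (elem_gf N - theta (elem_gf N)) = elem_gf N.
  have := elem_gf_words_gf N; rewrite mulrBr mulr1.
  by rewrite mulrBr ![words_gf N * _]mulrC => <-; ring.
by move=> n m mN; rewrite step // eqN EN.
Qed.

Lemma chromatic_twin n (v : 'I_n.+1) : is_end_vertex v ->
  chromatic (@twin (path_graph n.+1) v) =
  2%:R * chromatic (path_graph n.+2)
  - chromatic (path_graph 2) * chromatic (path_graph n).
Proof.
move=> end_v; apply: agreeP => N m mN.
rewrite (agree_twin end_v mN) twin_sumE.
have X k : agree N (word_sum N k) (chromatic (path_graph k)).
  by move=> m' mN'; rewrite (@agree_path N k m' mN').
by apply: agreeD mN; [apply: agreeM | apply/agreeN/agreeM].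
Qed.

(** * Closure properties of e-positivity *)

Section EPositivity.
Implicit Types (f g : xseries) (l : seq nat) (q : rat).

Lemma e_positive0 : e_positive 0.
Proof.
exists [fsfun]; last by move=> l; rewrite fsfunE.
by split=> [l|]; rewrite finsupp0 ?inE // big_nil.
Qed.

(** Allows two expansions to be added over a common index set: the additional lists have coefficient
    0. *)
Lemma e_expansion_widen (c : {fsfun seq nat -> rat with 0}) (A : {fset seq nat}) :
  (finsupp c `<=` A)%fset ->
  \sum_(l <- enum_fset (finsupp c)) c l *: elemsym_part l =
  \sum_(l <- enum_fset A) c l *: elemsym_part l.
Proof.
move=> cA; apply: big_fset_incl => // l _ /fsfun_dflt ->; exact: scale0r.
Qed.

Lemma e_positiveD f g : e_positive f -> e_positive g -> e_positive (f + g).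
Proof.
move=> [c [c_part fE] c_ge0] [d [d_part gE] d_ge0].
pose A := (finsupp c `|` finsupp d)%fset.
pose s : {fsfun seq nat -> rat with 0} := [fsfun l in A => c l + d l].
have sE l : s l = c l + d l.
  rewrite fsfunE in_fsetU; case: ifPn => // /norP[/fsfun_dflt -> /fsfun_dflt ->].
  by rewrite addr0.
have sA : (finsupp s `<=` A)%fset.
  apply/fsubsetP => l; apply: contraLR; rewrite in_fsetU memNfinsupp sE.
  by case/norP=> /fsfun_dflt -> /fsfun_dflt ->; rewrite addr0.
exists s => [|l]; last by rewrite sE addr_ge0.
split=> [l /(fsubsetP sA)|]; first by rewrite in_fsetU => /orP[/c_part|/d_part].
rewrite (e_expansion_widen sA) fE gE.
rewrite (e_expansion_widen (fsubsetUl _ (finsupp d))).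
rewrite (e_expansion_widen (fsubsetUr (finsupp c) _)) -big_split.
by apply: eq_bigr => l _; rewrite sE scalerDl.
Qed.

Lemma e_positive_sum (I : Type) (r : seq I) (P : pred I) (F : I -> xseries) :
  (forall i, P i -> e_positive (F i)) -> e_positive (\sum_(i <- r | P i) F i).
Proof. by move=> F_pos; apply: big_ind => //; [exact: e_positive0 | exact: e_positiveD]. Qed.

Lemma e_positive_elemsym_part q l : 0 <= q -> e_positive (q *: elemsym_part l).
Proof.
move=> q_ge0; pose l' := sort geq [seq i <- l | i != 0%N].
have -> : elemsym_part l = elemsym_part l'.
  rewrite /elemsym_part [RHS](perm_big [seq i <- l | i != 0%N]) ?perm_sort //=.
  rewrite big_filter [RHS]big_mkcond /=; apply: eq_bigr => i _.
  by case: eqP => [->|_] /=; rewrite ?elemsym0.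
pose c : {fsfun seq nat -> rat with 0} := [fsfun k in [fset l']%fset => q].
(* Only an inclusion holds: the support is empty if [q] is 0. *)
have cl : (finsupp c `<=` [fset l'])%fset.
  by apply/fsubsetP => k; apply: contraLR => kl; rewrite memNfinsupp fsfunE (negbTE kl).
exists c => [|k]; last by rewrite fsfunE; case: ifP.
split=> [k /(fsubsetP cl)|]; last first.
  by rewrite (e_expansion_widen cl) big_seq_fset1 fsfunE inE eqxx.
rewrite inE => /eqP ->; rewrite /is_partition sort_sorted /=; last first.
  by move=> a b; exact: leq_total.
by rewrite mem_sort mem_filter.
Qed.

Lemma e_positiveM f g : e_positive f -> e_positive g -> e_positive (f * g).
Proof.
move=> [c [_ ->] c_ge0] [d [_ ->] d_ge0]; rewrite big_distrl /=.
apply: e_positive_sum => k _; rewrite big_distrr /=.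
apply: e_positive_sum => l _; rewrite -scalerAl -scalerAr scalerA.
rewrite [elemsym_part k * _](_ : _ = elemsym_part (k ++ l)); last first.
  by rewrite /elemsym_part big_cat.
by apply: e_positive_elemsym_part; rewrite mulr_ge0.
Qed.

Lemma e_positive_elemsym n : e_positive (elemsym n).
Proof.
rewrite -[elemsym n]scale1r.
have -> : elemsym n = elemsym_part [:: n] by rewrite /elemsym_part big_seq1.
exact: e_positive_elemsym_part.
Qed.

Lemma e_positive_nat n : e_positive n%:R.
Proof.
elim: n => [|n IHn]; first exact: e_positive0.
by rewrite -natr1; apply: e_positiveD => //; rewrite -elemsym0; apply: e_positive_elemsym.
Qed.

Lemma e_positive_natBM n : (0 < n)%N -> e_positive ((n%:R - 1) * elemsym n).
Proof.
move=> n_gt0; rewrite -[1]/(1%:R) -natrB // subn1.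
exact: e_positiveM (e_positive_nat _) (e_positive_elemsym _).
Qed.

Lemma ze_positiveM (F G : zseries) :
  ze_positive F -> ze_positive G -> ze_positive (F * G).
Proof.
move=> F_pos G_pos n; rewrite [coef (F * G) n](coef_series_mul F G).
by apply: e_positive_sum => p _; apply: e_positiveM.
Qed.

Lemma ze_positive_G_ge k : (0 < k)%N -> ze_positive (G_ge k).
Proof.
move=> k_gt0 n; rewrite /=; case: ifP => [le_kn|_]; last exact: e_positive0.
exact: e_positive_natBM (leq_trans k_gt0 le_kn).
Qed.

Lemma ze_positive_elemsym k : ze_positive (zseries_from k elemsym).
Proof.
move=> n; rewrite /=; case: ifP => _; [exact: e_positive_elemsym | exact: e_positive0].
Qed.

End EPositivity.

(** * Recurrence, positivity and small cases for paths *)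

Lemma coef_zmul (F G : zseries) n :
  coef (F * G) n = \sum_(i < n.+1) coef F i * coef G (n - i)%N.
Proof.
rewrite [LHS](coef_series_mul F G).
rewrite -(big_mkord xpredT (fun i => coef F i * coef G (n - i)%N)).
rewrite -(big_map (fun i => (i, n - i)%N) xpredT (fun p => coef F p.1 * coef G p.2)).
apply: perm_big; apply: uniq_perm; rewrite ?decomp_uniq //.
  by rewrite map_inj_uniq ?iota_uniq // => i j [].
move=> [a b]; rewrite mem_decomp; apply/eqP/mapP => /= [<-|[i]].
  by exists a; rewrite ?mem_index_iota ?ltnS ?leq_addr //= -[(a + b)%R]/(a + b)%N addKn.
by rewrite mem_index_iota ltnS => le_in [-> ->]; exact: subnKC.
Qed.

(** The subtraction-free form of X D = E, suited to an induction for positivity. *)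
Lemma path_gf_rec : path_gf = path_gf * G_gf + zseries_from 0 elemsym.
Proof. by rewrite -path_gfE /D_gf mulrBr mulr1 addrC subrK. Qed.

(** The series G has no constant coefficient, so only shorter paths occur on the right. *)
Lemma chromatic_path_rec n : chromatic (path_graph n) =
  \sum_(i < n) chromatic (path_graph i) * coef G_gf (n - i)%N + elemsym n.
Proof.
have -> : chromatic (path_graph n) = coef path_gf n by [].
rewrite {1}path_gf_rec.
transitivity (coef (path_gf * G_gf) n + elemsym n) => //.
rewrite coef_zmul big_ord_recr /= subnn mulr0; congr (_ + _); exact: addr0.
Qed.

Lemma ze_positive_path_gf : ze_positive path_gf.
Proof.
move=> n; change (e_positive (chromatic (path_graph n))).
elim/ltn_ind: n => n IHn; rewrite chromatic_path_rec.
apply: e_positiveD (e_positive_elemsym n).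
apply: e_positive_sum => i _; apply: e_positiveM (IHn i (ltn_ord i)) _.
exact: ze_positive_G_ge.
Qed.

(** Five vertices are enough for the initial values: twinning the path on 4 vertices leads to the
    path on 5. *)
Lemma chromatic_path_small :
  [/\ chromatic (path_graph 0) = 1,
      chromatic (path_graph 1) = elemsym 1,
      chromatic (path_graph 2) = 2%:R * elemsym 2,
      chromatic (path_graph 3) = 3%:R * elemsym 3 + elemsym 1 * elemsym 2
    & chromatic (path_graph 4) =
        4%:R * elemsym 4 + 2%:R * elemsym 1 * elemsym 3 + 2%:R * elemsym 2 ^+ 2
      /\ chromatic (path_graph 5) =
        5%:R * elemsym 5 + 7%:R * elemsym 2 * elemsym 3
        + elemsym 1 * elemsym 2 ^+ 2 + 3%:R * elemsym 1 * elemsym 4].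
Proof.
have G1 : coef G_gf 1%N = 0 by [].
have Gk n : coef G_gf n.+2 = (n.+2%:R - 1) * elemsym n.+2 by [].
pose P n := chromatic (path_graph n).
have rec n : P n = \sum_(i < n) P i * coef G_gf (n - i)%N + elemsym n.
  exact: chromatic_path_rec.
have X0 : P 0%N = 1 by rewrite rec big_ord0 elemsym0 add0r.
have X1 : P 1%N = elemsym 1.
  have -> : P 1%N = 0 + P 0%N * coef G_gf 1%N + elemsym 1.
    by rewrite {1}rec !big_ord_recr big_ord0.
  by rewrite G1; ring.
have X2 : P 2%N = 2%:R * elemsym 2.
  have -> : P 2%N = 0 + P 0%N * coef G_gf 2%N + P 1%N * coef G_gf 1%N + elemsym 2.
    by rewrite {1}rec !big_ord_recr big_ord0.
  by rewrite G1 !Gk X0; ring.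
have X3 : P 3%N = 3%:R * elemsym 3 + elemsym 1 * elemsym 2.
  have -> : P 3%N = 0 + P 0%N * coef G_gf 3%N + P 1%N * coef G_gf 2%N
      + P 2%N * coef G_gf 1%N + elemsym 3.
    by rewrite {1}rec !big_ord_recr big_ord0.
  by rewrite G1 !Gk X0 X1; ring.
have X4 : P 4%N = 4%:R * elemsym 4 + 2%:R * elemsym 1 * elemsym 3 + 2%:R * elemsym 2 ^+ 2.
  have -> : P 4%N = 0 + P 0%N * coef G_gf 4%N + P 1%N * coef G_gf 3%N
      + P 2%N * coef G_gf 2%N + P 3%N * coef G_gf 1%N + elemsym 4.
    by rewrite {1}rec !big_ord_recr big_ord0.
  by rewrite G1 !Gk X0 X1 X2; ring.
have X5 : P 5%N = 5%:R * elemsym 5 + 7%:R * elemsym 2 * elemsym 3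
    + elemsym 1 * elemsym 2 ^+ 2 + 3%:R * elemsym 1 * elemsym 4.
  have -> : P 5%N = 0 + P 0%N * coef G_gf 5%N + P 1%N * coef G_gf 4%N
      + P 2%N * coef G_gf 3%N + P 3%N * coef G_gf 2%N
      + P 4%N * coef G_gf 1%N + elemsym 5.
    by rewrite {1}rec !big_ord_recr big_ord0.
  by rewrite G1 !Gk X0 X1 X2 X3; ring.
by split.
Qed.

(** * The generating function of the twinned paths *)

Lemma zseries_from_split (a : nat -> xseries) k :
  zseries_from k a = a k *: zvar ^+ k + zseries_from k.+1 a.
Proof.
apply: seriesP => n.
transitivity (a k * coef (zvar ^+ k) n + (if (k < n)%N then a n else 0)) => //.
rewrite coef_zvarX /=; case: ltngtP => [_|_|->].
- by rewrite mulr0 add0r.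
- by rewrite mulr0 addr0.
by rewrite mulr1 addr0.
Qed.

Lemma elemsym_gf_split :
  zseries_from 0 elemsym = 1 + elemsym 1 *: zvar + zseries_from 2 elemsym.
Proof.
rewrite (zseries_from_split _ 0) (zseries_from_split _ 1).
by rewrite expr0 elemsym0 scale1r expr1 addrA.
Qed.

Lemma zseries_fromD k a b :
  zseries_from k a + zseries_from k b = zseries_from k (fun i => a i + b i).
Proof.
apply: seriesP => n /=; case: (k <= n)%N => //; exact: addr0.
Qed.

(** The twin relation says that half the series is X - 1 - e_1 z - e_2 z^2 X. Substituting X = X G +
    E with G = e_2 z^2 + G_{>=3} cancels the negative terms. *)
Lemma twinned_path_gfE (v : forall n, 'I_n.+1) :
  (forall n, is_end_vertex (v n)) ->
  twinned_path_gf v = (path_gf * G_ge 3 + zseries_from 2 elemsym) *+ 2.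
Proof.
move=> end_v; have [X0 X1 X2 _ _] := chromatic_path_small.
(* Removing 1 and e_1 z clears degrees 0 and 1, where no twinned path contributes; degree n + 2 is
   [chromatic_twin] with X_{P_2} = 2 e_2. *)
have -> : twinned_path_gf v = (path_gf - 1 - elemsym 1 *: zvar) *+ 2
    - (elemsym 2 *: zvar ^+ 2) * path_gf *+ 2.
  rewrite -scalerAl exprS expr1 -mulrA; apply: seriesP => n.
  pose c k : xseries := coef path_gf k - (k == 0%N)%:R - elemsym 1 * (k == 1%N)%:R.
  pose d k : xseries := elemsym 2 * coef (zvar * (zvar * path_gf)) k.
  transitivity (c n + c n - (d n + d n)) => //.
  case: n => [|[|n]]; rewrite /c /d !coef_zvarM /=.
  - by rewrite X0; ring.
  - by rewrite X1; ring.
  by rewrite chromatic_twin // X2; ring.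
rewrite {1}path_gf_rec elemsym_gf_split.
have -> : G_gf = elemsym 2 *: zvar ^+ 2 + G_ge 3.
  have e2 : (2%:R - 1) * elemsym 2 = elemsym 2 by ring.
  by rewrite /G_gf /G_ge (zseries_from_split _ 2) e2.
ring.
Qed.
Theorem proposition3p9 (v : forall n : nat, 'I_n.+1)
    (hv : forall n : nat, is_end_vertex (v n)) :
  (* X n is the symmetric function of P_(n+1) twinned at its end vertex v n *)
  let X (n : nat) : xseries := chromatic (@twin (path_graph n.+1) (v n)) in
  let e := elemsym in
  let half : xseries := (2%:R^-1 : rat)%:A in
  let z := zvar in
  [/\ half *: twinned_path_gf v =
        K_gf * (G_ge 3 / D_gf) + (e 1%N *: z) * G_gf * (G_ge 3 / D_gf)
        + e 2%N *: z ^+ 2 + zseries_from 3 (fun i => i%:R * e i)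
        + (e 1%N *: z) * G_ge 3,
      forall n : nat, e_positive (X n),
      [/\ X 0%N = 2%:R * e 2%N,
          X 1%N = 2%:R * (3%:R * e 3%N),
          X 2%N = 2%:R * (4%:R * e 4%N + 2%:R * e 1%N * e 3%N)
        & X 3%N = 2%:R * (4%:R * e 2%N * e 3%N + 3%:R * e 1%N * e 4%N
                          + 5%:R * e 5%N)],
      half *: twinned_path_gf v = path_gf * G_ge 3 + zseries_from 2 e
    & [/\ ze_positive path_gf, ze_positive (G_ge 3),
          ze_positive (zseries_from 2 e)
        & ze_positive (path_gf * G_ge 3 + zseries_from 2 e)]].
Proof.
move=> X e half z.
have pos : ze_positive (path_gf * G_ge 3 + zseries_from 2 e).
  move=> n; apply: e_positiveD; last exact: ze_positive_elemsym.
  by apply: ze_positiveM; [exact: ze_positive_path_gf | exact: ze_positive_G_ge].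
have halfK (F : zseries) : half *: (F *+ 2) = F.
  rewrite -scaler_nat scalerA.
  have -> : half * 2%:R = 1.
    by rewrite mulr_natr /half scalerMnl -mulr_natr mulVf // scale1r.
  exact: scale1r.
have halfE : half *: twinned_path_gf v = path_gf * G_ge 3 + zseries_from 2 e.
  by rewrite twinned_path_gfE.
split=> //.
- rewrite halfE.
  have KE : K_gf = zseries_from 2 e + G_gf.
    rewrite /K_gf /G_gf /G_ge zseries_fromD; congr zseries_from.
    by apply: funext => i; rewrite /e; ring.
  have G3E : G_ge 3 + zseries_from 3 e = zseries_from 3 (fun i => i%:R * e i).
    rewrite /G_ge zseries_fromD; congr zseries_from.
    by apply: funext => i; rewrite /e; ring.
  have XD : path_gf * D_gf = 1 + e 1%N *: z + zseries_from 2 e.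
    by rewrite path_gfE elemsym_gf_split.
  (* With Q = G_{>=3} / D, the product X G_{>=3} becomes Q (X D) = Q (1 + e_1 z + sum_{i>=2} e_i
     z^i). On the other side, G_{>=3} = Q - Q G merges each Q G with a G_{>=3} into Q. *)
  rewrite -G3E KE; set Q := G_ge 3 / D_gf.
  have G3Q : G_ge 3 = Q * D_gf by rewrite divrK // D_gf_unit.
  rewrite {1}G3Q mulrCA XD.
  have -> : zseries_from 2 e = e 2%N *: z ^+ 2 + zseries_from 3 e.
    exact: zseries_from_split.
  rewrite G3Q /D_gf; ring.
(* [X n] is the coefficient of z^(n+2) in twice the positive series. *)
- move=> n; have := congr1 (fun F => coef F n.+2) (twinned_path_gfE hv).
  move=> /= twE; rewrite /X twE.
  by apply: e_positiveD; exact: pos.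
- have [X0 X1 X2 X3 [X4 X5]] := chromatic_path_small.
  rewrite /X !chromatic_twin // X0 X1 X2 X3 X4 X5 /e.
  by split; ring.
by split=> //; [exact: ze_positive_path_gf | exact: ze_positive_G_ge
  | exact: ze_positive_elemsym].
Qed.
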